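(* Let $0<q<1$. For complex numbers $a,b,c,d$ with $\mathrm{Re}(a+b+c+d-1/2)>0$, and such that every $q^2$-gamma value occurring below is evaluated at a point that is not a non-positive integer, \[ \sum_{n=0}^{\infty}\frac{(1-q^{4n+2a})(1|q^{2})_{a+n-1}(1/2|q^{2})_{n-b}(1/2|q^{2})_{n-c}(1/2|q^{2})_{n-d}}{(1-q^{2})[n]_{q^{2}}!\,(1/2|q^{2})_{a+b+n}(1/2|q^{2})_{a+c+n}(1/2|q^{2})_{a+d+n}}\,q^{2(a+b+c+d)n-n} =\frac{\pi_{q}^{2}\,(1/2|q^{2})_{-b}(1/2|q^{2})_{-c}(1/2|q^{2})_{-d}(1/2|q^{2})_{a+b+c+d-1}}{(1|q^{2})_{a+b+c-1}(1|q^{2})_{a+b+d-1}(1|q^{2})_{a+c+d-1}\,q^{1/2}}. \]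
   Context: Let $0<q<1$ and write $q^{x}=e^{x\log q}$. $(z;q)_\infty=\prod_{k\ge0}(1-zq^k)$. $\Gamma_{q^2}(x)=\frac{(q^2;q^2)_\infty}{(q^{2x};q^2)_\infty}(1-q^2)^{1-x}$; for complex $x,\alpha$, $(x|q^2)_\alpha=\Gamma_{q^2}(x+\alpha)/\Gamma_{q^2}(x)$. $[z]_{q^2}=\frac{1-q^{2z}}{1-q^2}$, $[0]_{q^2}!=1$, $[n]_{q^2}!=\prod_{k=1}^n[k]_{q^2}$. $\pi_q=(1-q^2)q^{1/4}\frac{(q^2;q^2)_\infty^2}{(q;q^2)_\infty^2}$.
   Formalization: In π_q the denominator is taken as (q;q^2)_∞^2 instead of (q;q)_∞^2, with which the identity is off by a factor (q^2;q^2)_∞^{-4}; the gamma values are assumed to avoid all poles of Γ_{q^2}, including the non-real ones -k+iπm/log q, not only non-positive integers. *)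

(* Defs.v *)
From Stdlib Require Import Reals Lra ClassicalEpsilon.
Open Scope R_scope.

Record Cx : Type := mkC { Re : R ; Im : R }.

Definition RtoC (x : R) : Cx := mkC x 0.
Definition C0 : Cx := RtoC 0.
Definition C1 : Cx := RtoC 1.
Definition Cadd (z w : Cx) : Cx := mkC (Re z + Re w) (Im z + Im w).
Definition Copp (z : Cx) : Cx := mkC (- Re z) (- Im z).
Definition Csub (z w : Cx) : Cx := Cadd z (Copp w).
Definition Cmul (z w : Cx) : Cx :=
  mkC (Re z * Re w - Im z * Im w) (Re z * Im w + Im z * Re w).
Definition Cinv (z : Cx) : Cx :=
  let r2 := Re z * Re z + Im z * Im z in mkC (Re z / r2) (- Im z / r2).
Definition Cdiv (z w : Cx) : Cx := Cmul z (Cinv w).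
Definition Cnorm (z : Cx) : R := sqrt (Re z * Re z + Im z * Im z).

Definition Cexp (z : Cx) : Cx :=
  mkC (exp (Re z) * cos (Im z)) (exp (Re z) * sin (Im z)).

Definition Cpow (p : R) (x : Cx) : Cx := Cexp (Cmul x (RtoC (ln p))).

Definition C_cv (u : nat -> Cx) (l : Cx) : Prop :=
  forall eps : R, eps > 0 -> exists N : nat, forall n : nat, (n >= N)%nat ->
    Cnorm (Csub (u n) l) < eps.

Fixpoint qpoch_part (z : Cx) (p : R) (n : nat) : Cx :=
  match n with
  | O => C1
  | S m => Cmul (qpoch_part z p m) (Csub C1 (Cmul z (RtoC (p ^ m))))
  end.

Definition C_lim (u : nat -> Cx) : Cx :=
  epsilon (inhabits C0) (fun l => C_cv u l).

Definition qpoch_inf (z : Cx) (p : R) : Cx := C_lim (qpoch_part z p).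

Definition qGamma2 (q : R) (x : Cx) : Cx :=
  Cmul (Cdiv (qpoch_inf (RtoC (q ^ 2)) (q ^ 2))
             (qpoch_inf (Cpow q (Cmul (RtoC 2) x)) (q ^ 2)))
       (Cpow (1 - q ^ 2) (Csub C1 x)).

Definition qGamma2_defined (q : R) (x : Cx) : Prop :=
  qpoch_inf (Cpow q (Cmul (RtoC 2) x)) (q ^ 2) <> C0.

Definition qshift2 (q : R) (x alpha : Cx) : Cx :=
  Cdiv (qGamma2 q (Cadd x alpha)) (qGamma2 q x).

Definition qint2 (q : R) (k : nat) : R := (1 - (q ^ 2) ^ k) / (1 - q ^ 2).
Fixpoint qfact2 (q : R) (n : nat) : R :=
  match n with
  | O => 1
  | S m => qfact2 q m * qint2 q (S m)
  end.

Definition pi_q (q : R) : Cx :=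
  Cmul (RtoC ((1 - q ^ 2) * Rpower q (1/4)))
       (Cdiv (Cmul (qpoch_inf (RtoC (q ^ 2)) (q ^ 2)) (qpoch_inf (RtoC (q ^ 2)) (q ^ 2)))
             (Cmul (qpoch_inf (RtoC q) (q ^ 2)) (qpoch_inf (RtoC q) (q ^ 2)))).

Fixpoint Csum (f : nat -> Cx) (N : nat) : Cx :=
  match N with
  | O => C0
  | S m => Cadd (Csum f m) (f m)
  end.

Definition Cseries_cv (f : nat -> Cx) (l : Cx) : Prop := C_cv (Csum f) l.

Definition Chalf : Cx := RtoC (1/2).
Definition CN (n : nat) : Cx := RtoC (INR n).

Definition thm41_term (q : R) (a b c d : Cx) (n : nat) : Cx :=
  let s := Cadd (Cadd a b) (Cadd c d) in
  Cmul
   (Cdiv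
     (Cmul (Cmul (Cmul (Cmul
        (Csub C1 (Cpow q (Cadd (CN (4 * n)) (Cmul (RtoC 2) a))))
        (qshift2 q C1 (Csub (Cadd a (CN n)) C1)))
        (qshift2 q Chalf (Csub (CN n) b)))
        (qshift2 q Chalf (Csub (CN n) c)))
        (qshift2 q Chalf (Csub (CN n) d)))
     (Cmul (Cmul (Cmul
        (RtoC ((1 - q ^ 2) * qfact2 q n))
        (qshift2 q Chalf (Cadd (Cadd a b) (CN n))))
        (qshift2 q Chalf (Cadd (Cadd a c) (CN n))))
        (qshift2 q Chalf (Cadd (Cadd a d) (CN n)))))
   (Cpow q (Csub (Cmul (Cmul (RtoC 2) s) (CN n)) (CN n))).

Definition thm41_rhs (q : R) (a b c d : Cx) : Cx :=
  let s := Cadd (Cadd a b) (Cadd c d) in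
  Cdiv
    (Cmul (Cmul (Cmul (Cmul (Cmul (pi_q q) (pi_q q))
       (qshift2 q Chalf (Copp b)))
       (qshift2 q Chalf (Copp c)))
       (qshift2 q Chalf (Copp d)))
       (qshift2 q Chalf (Csub s C1)))
    (Cmul (Cmul (Cmul
       (qshift2 q C1 (Csub (Cadd (Cadd a b) c) C1))
       (qshift2 q C1 (Csub (Cadd (Cadd a b) d) C1)))
       (qshift2 q C1 (Csub (Cadd (Cadd a c) d) C1)))
       (RtoC (Rpower q (1/2)))).

(* Main.v *)
(* With p = q^2, A = q^(2a), B = q^(1-2b), C = q^(1-2c), D = q^(1-2d), the series is a
   constant multiple of Rogers' nonterminating 6phi5 sum, with argument
   z = Ap/(BCD) = q^(2(a+b+c+d)-1).

   Rogers' sum has a telescoping proof.  Let T(A,n) be its n-th term and R(A) its value, an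
   infinite product.  Then T(A,n) - (R(A)/R(Ap)) T(Ap,n) = g(n+1) - g(n), where
   g(n) = - T(A,n) (1-p^n) (1-A z p^n) / ((1-A p^(2n)) (1-z)), and g(0) = 0.  Hence the
   partial sums satisfy S_N(A) = (R(A)/R(Ap)) S_N(Ap) + g(N).  Iterating A -> Ap -> Ap^2 -> ...
   for fixed N, the sums S_N(Ap^m) tend to 1 and the accumulated error is O(|z|^N), so that
   S_N(A) = R(A) + O(|z|^N). *)

From Stdlib Require Import Reals Lra Lia ClassicalEpsilon.
From Coquelicot Require Import Rbar Lim_seq.
From Coquelicot Require Complex.
Require Import Defs.
Open Scope R_scope.

Declare Scope cx_scope.
Delimit Scope cx_scope with Cx.
Infix "+" := Cadd : cx_scope.
Infix "-" := Csub : cx_scope.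
Infix "*" := Cmul : cx_scope.
Infix "/" := Cdiv : cx_scope.
Notation "- z" := (Copp z) : cx_scope.
Notation "/ z" := (Cinv z) : cx_scope.
Bind Scope cx_scope with Cx.

(** * The field of complex numbers and limits *)

Lemma Cx_ext (z w : Cx) : Re z = Re w -> Im z = Im w -> z = w.
Proof. destruct z, w; simpl; intros -> ->; reflexivity. Qed.

Lemma Cx_sqr_pos (z : Cx) : z <> C0 -> 0 < Re z * Re z + Im z * Im z.
Proof.
intros hz.
destruct (Req_dec (Re z) 0) as [h1|h1]; [destruct (Req_dec (Im z) 0) as [h2|h2]|].
- now elim hz; apply Cx_ext.
- nra.
- nra.
Qed.

Lemma Cx_field : field_theory C0 C1 Cadd Cmul Csub Copp Cdiv Cinv eq.
Proof.
constructor; [constructor| | |];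
  try (intros; apply Cx_ext; simpl; ring).
- intros h; injection h; lra.
- intros z hz; pose proof (Cx_sqr_pos z hz).
  apply Cx_ext; simpl; field; lra.
Qed.

Add Field Cx_field_instance : Cx_field.

Lemma C1_neq0 : C1 <> C0.
Proof. apply (F_1_neq_0 Cx_field). Qed.

Lemma RtoC_add (x y : R) : RtoC (x + y) = (RtoC x + RtoC y)%Cx.
Proof. apply Cx_ext; simpl; ring. Qed.

Lemma RtoC_sub (x y : R) : RtoC (x - y) = (RtoC x - RtoC y)%Cx.
Proof. apply Cx_ext; simpl; ring. Qed.

Lemma RtoC_mul (x y : R) : RtoC (x * y) = (RtoC x * RtoC y)%Cx.
Proof. apply Cx_ext; simpl; ring. Qed.

Lemma RtoC_inv (x : R) : x <> 0 -> RtoC (/ x) = (/ RtoC x)%Cx.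
Proof. intros hx; apply Cx_ext; simpl; field; auto; nra. Qed.

Lemma RtoC_div (x y : R) : y <> 0 -> RtoC (x / y) = (RtoC x / RtoC y)%Cx.
Proof. intros hy; unfold Rdiv, Cdiv; now rewrite RtoC_mul, RtoC_inv. Qed.

Lemma RtoC_neq0 (x : R) : x <> 0 -> RtoC x <> C0.
Proof. intros hx h; apply hx; now injection h. Qed.

Lemma Cmul_neq0 (z w : Cx) : z <> C0 -> w <> C0 -> (z * w)%Cx <> C0.
Proof.
intros hz hw h; apply hw.
transitivity (/ z * (z * w))%Cx; [now field | rewrite h; now field].
Qed.

Lemma Cinv_neq0 (z : Cx) : z <> C0 -> (/ z)%Cx <> C0.
Proof.
intros hz h; apply C1_neq0.
transitivity (/ z * z)%Cx; [now field | rewrite h; ring].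
Qed.

Lemma Cdiv_neq0 (z w : Cx) : z <> C0 -> w <> C0 -> (z / w)%Cx <> C0.
Proof. intros hz hw; apply Cmul_neq0; [|apply Cinv_neq0]; assumption. Qed.

Lemma Cmul_neq0_l (z w : Cx) : (z * w)%Cx <> C0 -> z <> C0.
Proof. intros h ->; apply h; ring. Qed.

(** Bridge to Coquelicot's modulus, from which multiplicativity and the triangle inequality are
    inherited. *)
Lemma Cnorm_Cmod (z : Cx) : Cnorm z = Complex.Cmod (Re z, Im z).
Proof. unfold Cnorm, Complex.Cmod; simpl; f_equal; ring. Qed.

Lemma Cnorm_ge0 (z : Cx) : 0 <= Cnorm z.
Proof. apply sqrt_pos. Qed.

Lemma Cnorm_mul (z w : Cx) : Cnorm (z * w) = Cnorm z * Cnorm w.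
Proof.
rewrite !Cnorm_Cmod, <- Complex.Cmod_mult; reflexivity.
Qed.

Lemma Cnorm_add_le (z w : Cx) : Cnorm (z + w) <= Cnorm z + Cnorm w.
Proof. rewrite !Cnorm_Cmod; apply (Complex.Cmod_triangle (_, _) (_, _)). Qed.

Lemma Cnorm_opp (z : Cx) : Cnorm (- z) = Cnorm z.
Proof. unfold Cnorm; simpl; f_equal; ring. Qed.

Lemma Cnorm_sub_le (z w : Cx) : Cnorm (z - w) <= Cnorm z + Cnorm w.
Proof. rewrite <- (Cnorm_opp w); apply Cnorm_add_le. Qed.

Lemma Cnorm_sub_ge (z w : Cx) : Cnorm z - Cnorm w <= Cnorm (z - w).
Proof.
pose proof (Cnorm_add_le (z - w) w) as h.
replace (z - w + w)%Cx with z in h by ring; lra.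
Qed.

Lemma Cnorm_RtoC (x : R) : Cnorm (RtoC x) = Rabs x.
Proof. unfold Cnorm; simpl; rewrite <- sqrt_Rsqr_abs; unfold Rsqr; f_equal; ring. Qed.

Lemma Cnorm_RtoC_pow (p : R) (n : nat) : 0 <= p -> Cnorm (RtoC (p ^ n)) = p ^ n.
Proof. intros hp; rewrite Cnorm_RtoC; apply Rabs_pos_eq, pow_le, hp. Qed.

Lemma Cnorm_C1 : Cnorm C1 = 1.
Proof. unfold C1; rewrite Cnorm_RtoC; apply Rabs_R1. Qed.

Lemma Cnorm_C0 : Cnorm C0 = 0.
Proof. unfold C0; rewrite Cnorm_RtoC; apply Rabs_R0. Qed.

Lemma Re_le_Cnorm (z : Cx) : Rabs (Re z) <= Cnorm z.
Proof.
unfold Cnorm; rewrite <- sqrt_Rsqr_abs; apply sqrt_le_1_alt; unfold Rsqr; nra.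
Qed.

Lemma Im_le_Cnorm (z : Cx) : Rabs (Im z) <= Cnorm z.
Proof.
unfold Cnorm; rewrite <- sqrt_Rsqr_abs; apply sqrt_le_1_alt; unfold Rsqr; nra.
Qed.

Lemma Cnorm_le_ReIm (z : Cx) : Cnorm z <= Rabs (Re z) + Rabs (Im z).
Proof.
replace z with (RtoC (Re z) + mkC 0 1 * RtoC (Im z))%Cx at 1
  by (apply Cx_ext; simpl; ring).
eapply Rle_trans; [apply Cnorm_add_le|].
rewrite Cnorm_mul, !Cnorm_RtoC.
replace (Cnorm (mkC 0 1)) with 1; [lra|].
symmetry; unfold Cnorm; simpl; replace (0 * 0 + 1 * 1) with 1 by ring; apply sqrt_1.
Qed.

(** * Limits of complex sequences *)

Lemma C_cv_ReIm (u : nat -> Cx) (l : Cx) :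
  C_cv u l <-> Un_cv (fun n => Re (u n)) (Re l) /\ Un_cv (fun n => Im (u n)) (Im l).
Proof.
split.
- intros h; split; intros eps he; destruct (h eps he) as [N hN]; exists N;
    intros n hn; specialize (hN n hn); unfold Rdist.
  + eapply Rle_lt_trans; [apply (Re_le_Cnorm (u n - l))|exact hN].
  + eapply Rle_lt_trans; [apply (Im_le_Cnorm (u n - l))|exact hN].
- intros [h1 h2] eps he.
  destruct (h1 (eps / 2)) as [N1 hN1]; [lra|].
  destruct (h2 (eps / 2)) as [N2 hN2]; [lra|].
  exists (Nat.max N1 N2); intros n hn.
  eapply Rle_lt_trans; [apply Cnorm_le_ReIm|].
  specialize (hN1 n ltac:(lia)); specialize (hN2 n ltac:(lia)).
  unfold Rdist, Rminus in *; simpl; lra.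
Qed.

Lemma C_cv_unique (u : nat -> Cx) (l m : Cx) : C_cv u l -> C_cv u m -> l = m.
Proof.
rewrite !C_cv_ReIm; intros [? ?] [? ?]; apply Cx_ext; eapply UL_sequence; eassumption.
Qed.

Lemma C_cv_ext (u v : nat -> Cx) (l : Cx) :
  (forall n, u n = v n) -> C_cv u l -> C_cv v l.
Proof.
intros e h eps he; destruct (h eps he) as [N hN]; exists N; intros n hn.
rewrite <- e; auto.
Qed.

Lemma C_cv_const (l : Cx) : C_cv (fun _ => l) l.
Proof.
intros eps he; exists 0%nat; intros n _.
replace (l - l)%Cx with C0 by ring; now rewrite Cnorm_C0.
Qed.

Lemma C_cv_add (u v : nat -> Cx) (l m : Cx) :
  C_cv u l -> C_cv v m -> C_cv (fun n => u n + v n)%Cx (l + m)%Cx.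
Proof.
rewrite !C_cv_ReIm; intros [? ?] [? ?]; split; apply CV_plus; assumption.
Qed.

Lemma C_cv_mul (u v : nat -> Cx) (l m : Cx) :
  C_cv u l -> C_cv v m -> C_cv (fun n => u n * v n)%Cx (l * m)%Cx.
Proof.
rewrite !C_cv_ReIm; intros [? ?] [? ?]; split; simpl;
  [apply CV_minus | apply CV_plus]; apply CV_mult; assumption.
Qed.

Lemma C_cv_inv (u : nat -> Cx) (l : Cx) :
  C_cv u l -> l <> C0 -> C_cv (fun n => / u n)%Cx (/ l)%Cx.
Proof.
rewrite !C_cv_ReIm; intros [h1 h2] hl.
pose proof (Cx_sqr_pos l hl) as hpos.
assert (h : is_lim_seq (fun n => / (Re (u n) * Re (u n) + Im (u n) * Im (u n)))
              (/ (Re l * Re l + Im l * Im l))).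
{ apply (is_lim_seq_inv _ (Finite (Re l * Re l + Im l * Im l))).
  - apply is_lim_seq_Reals, CV_plus; apply CV_mult; assumption.
  - intros e; injection e; lra. }
apply is_lim_seq_Reals in h.
split; simpl; unfold Rdiv; apply CV_mult; auto.
now apply CV_opp.
Qed.

Lemma C_cv_div (u v : nat -> Cx) (l m : Cx) :
  C_cv u l -> C_cv v m -> m <> C0 -> C_cv (fun n => u n / v n)%Cx (l / m)%Cx.
Proof. intros hu hv hm; apply C_cv_mul; [|apply C_cv_inv]; assumption. Qed.

Lemma C_cv_shift (u : nat -> Cx) (l : Cx) (k : nat) :
  C_cv u l -> C_cv (fun n => u (k + n)%nat) l.
Proof.
intros h eps he; destruct (h eps he) as [N hN]; exists N; intros n hn.
apply hN; lia.
Qed.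

Lemma C_cv_bounded (u : nat -> Cx) (l : Cx) :
  C_cv u l -> exists M, forall n, Cnorm (u n) <= M.
Proof.
rewrite C_cv_ReIm; intros [h1 h2].
destruct (maj_by_pos _ (exist _ _ h1)) as [M1 [_ hM1]].
destruct (maj_by_pos _ (exist _ _ h2)) as [M2 [_ hM2]].
exists (M1 + M2); intros n; eapply Rle_trans; [apply Cnorm_le_ReIm|].
apply Rplus_le_compat; auto.
Qed.

(** Closed balls are closed: if the limit lay outside, a term closer to it than the gap
    [Cnorm (l - v) - M] would violate the bound. *)
Lemma C_cv_norm_le (u : nat -> Cx) (v : Cx) (l : Cx) (M : R) :
  C_cv u l -> (forall n, Cnorm (u n - v) <= M) -> Cnorm (l - v) <= M.
Proof.
intros h hM; apply Rnot_lt_le; intros hlt.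
destruct (h (Cnorm (l - v) - M)) as [N hN]; [lra|].
specialize (hN N (le_n N)); specialize (hM N).
pose proof (Cnorm_sub_le (u N - v) (u N - l)) as ht.
replace (u N - v - (u N - l))%Cx with (l - v)%Cx in ht by ring; lra.
Qed.

(** [C_lim] is a choice by [epsilon], so it is known to be a limit only once some limit has been
    exhibited. *)
Lemma C_cv_lim (u : nat -> Cx) (l : Cx) : C_cv u l -> C_cv u (C_lim u).
Proof. intros h; unfold C_lim; apply epsilon_spec; now exists l. Qed.

(** The increments are summed as a geometric series. The bound is uniform in [k]: it gives the
    Cauchy property, and at [n = 0] it controls the total drift of a sequence from its first
    term. *)
Lemma C_cv_geometric_bound (u : nat -> Cx) (K r : R) :
  0 <= r < 1 -> (forall n, Cnorm (u n - u (S n)) <= K * r ^ n) ->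
  forall n k, Cnorm (u (n + k)%nat - u n) <= K / (1 - r) * r ^ n.
Proof.
intros hr hu n k.
assert (hK : 0 <= K).
{ pose proof (hu 0%nat) as h; pose proof (Cnorm_ge0 (u 0%nat - u 1%nat)); simpl in h; lra. }
(* The induction needs the exact finite geometric sum; the cruder bound by the full series is not
   inductive. *)
assert (hs : Cnorm (u (n + k)%nat - u n) <= K * r ^ n * ((1 - r ^ k) / (1 - r))).
{ induction k as [|k IH].
  - rewrite Nat.add_0_r; replace (u n - u n)%Cx with C0 by ring.
    rewrite Cnorm_C0; simpl; right; field; lra.
  - rewrite Nat.add_succ_r.
    replace (u (S (n + k)) - u n)%Cx
      with ((u (n + k)%nat - u n) - (u (n + k)%nat - u (S (n + k))))%Cx by ring.
    eapply Rle_trans; [apply Cnorm_sub_le|].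
    eapply Rle_trans; [apply Rplus_le_compat; [exact IH|apply hu]|].
    rewrite pow_add; right; simpl; field; lra. }
eapply Rle_trans; [exact hs|].
replace (K / (1 - r) * r ^ n) with (K * r ^ n * (1 / (1 - r))) by (field; lra).
pose proof (pow_le r n (proj1 hr)); pose proof (pow_le r k (proj1 hr)).
apply Rmult_le_compat_l; [nra|].
apply Rmult_le_compat_r; [|lra].
left; apply Rinv_0_lt_compat; lra.
Qed.

Lemma pow_small (K r eps : R) : 0 <= K -> 0 <= r < 1 -> 0 < eps ->
  exists N, forall n, (n >= N)%nat -> K * r ^ n < eps.
Proof.
intros hK hr he.
(* Dividing by [K + 1] rather than [K] covers [K = 0]. *)
destruct (pow_lt_1_zero r ltac:(rewrite Rabs_pos_eq; lra) (eps / (K + 1))) as [N hN].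
{ apply Rdiv_lt_0_compat; lra. }
exists N; intros n hn; specialize (hN n hn).
pose proof (pow_le r n (proj1 hr)) as h0.
rewrite Rabs_pos_eq in hN by assumption.
apply (Rmult_lt_compat_r (K + 1)) in hN; [|lra].
replace (eps / (K + 1) * (K + 1)) with eps in hN by (field; lra); nra.
Qed.

Lemma C_cv_geometric (u : nat -> Cx) (K r : R) :
  0 <= r < 1 -> (forall n, Cnorm (u n - u (S n)) <= K * r ^ n) ->
  exists l, C_cv u l.
Proof.
intros hr hu.
pose proof (C_cv_geometric_bound u K r hr hu) as hb.
assert (hK : 0 <= K / (1 - r)).
{ pose proof (hb 0%nat 0%nat) as h.
  pose proof (Cnorm_ge0 (u (0 + 0)%nat - u 0%nat)); simpl in *; lra. }
assert (hc : forall eps, eps > 0 -> exists N, forall n m, (n >= N)%nat -> (m >= N)%nat ->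
          Cnorm (u n - u m) < eps).
{ intros eps he; destruct (pow_small _ r (eps / 2) hK hr) as [N hN]; [lra|].
  exists N; intros n m hn hm.
  pose proof (hb N (n - N)%nat) as h1; pose proof (hb N (m - N)%nat) as h2.
  replace (N + (n - N))%nat with n in h1 by lia.
  replace (N + (m - N))%nat with m in h2 by lia.
  pose proof (hN N (le_n N)).
  pose proof (Cnorm_sub_le (u n - u N) (u m - u N)) as ht.
  replace (u n - u N - (u m - u N))%Cx with (u n - u m)%Cx in ht by ring; lra. }
destruct (R_complete (fun n => Re (u n))) as [x hx].
{ intros eps he; destruct (hc eps he) as [N hN]; exists N; intros n m hn hm.
  eapply Rle_lt_trans; [apply (Re_le_Cnorm (u n - u m))|auto]. }
destruct (R_complete (fun n => Im (u n))) as [y hy].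
{ intros eps he; destruct (hc eps he) as [N hN]; exists N; intros n m hn hm.
  eapply Rle_lt_trans; [apply (Im_le_Cnorm (u n - u m))|auto]. }
exists (mkC x y); apply C_cv_ReIm; split; assumption.
Qed.
(** * The infinite q-shifted factorial *)

Lemma exp_le_exp (x y : R) : x <= y -> exp x <= exp y.
Proof. intros [h| ->]; [left; now apply exp_increasing|right; reflexivity]. Qed.

(** Each factor has modulus at most [1 + |z| p^k <= exp (|z| p^k)], and the exponents add up to a
    geometric series. *)
Lemma qpoch_part_norm_le (z : Cx) (p : R) (n : nat) : 0 <= p < 1 ->
  Cnorm (qpoch_part z p n) <= exp (Cnorm z / (1 - p)).
Proof.
intros hp; pose proof (Cnorm_ge0 z) as hz.
apply Rle_trans with (exp (Cnorm z * ((1 - p ^ n) / (1 - p)))).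
- induction n as [|n IH]; cbn [qpoch_part].
  + rewrite Cnorm_C1; simpl.
    replace (Cnorm z * ((1 - 1) / (1 - p))) with 0 by (field; lra).
    rewrite exp_0; lra.
  + rewrite Cnorm_mul.
    replace (Cnorm z * ((1 - p ^ S n) / (1 - p)))
      with (Cnorm z * ((1 - p ^ n) / (1 - p)) + Cnorm z * p ^ n) by (simpl; field; lra).
    rewrite exp_plus.
    apply Rmult_le_compat; auto using Cnorm_ge0.
    eapply Rle_trans; [apply Cnorm_sub_le|].
    rewrite Cnorm_C1, Cnorm_mul, Cnorm_RtoC_pow by lra.
    apply exp_ineq1_le.
- apply exp_le_exp; unfold Rdiv; apply Rmult_le_compat_l; [assumption|].
  pose proof (pow_le p n (proj1 hp)).
  rewrite <- (Rmult_1_l (/ (1 - p))) at 2.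
  apply Rmult_le_compat_r; [left; apply Rinv_0_lt_compat|]; lra.
Qed.

(** Consecutive partial products differ by [qpoch_part z p n * z * p^n], which is geometrically
    small because the partial products are bounded. *)
Lemma qpoch_cv (z : Cx) (p : R) : 0 <= p < 1 ->
  C_cv (qpoch_part z p) (qpoch_inf z p).
Proof.
intros hp.
destruct (C_cv_geometric (qpoch_part z p) (exp (Cnorm z / (1 - p)) * Cnorm z) p hp)
  as [l hl]; [|now apply (C_cv_lim _ l)].
intros n; cbn [qpoch_part].
replace (qpoch_part z p n - qpoch_part z p n * (C1 - z * RtoC (p ^ n)))%Cx
  with (qpoch_part z p n * (z * RtoC (p ^ n)))%Cx by ring.
rewrite !Cnorm_mul, Cnorm_RtoC_pow, <- Rmult_assoc by lra.
apply Rmult_le_compat_r; [apply pow_le; lra|].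
apply Rmult_le_compat_r; [apply Cnorm_ge0|now apply qpoch_part_norm_le].
Qed.

Lemma qpoch_part_add (z : Cx) (p : R) (m n : nat) :
  qpoch_part z p (m + n) = (qpoch_part z p m * qpoch_part (z * RtoC (p ^ m)) p n)%Cx.
Proof.
induction n as [|n IH].
- rewrite Nat.add_0_r; simpl; ring.
- rewrite Nat.add_succ_r; cbn [qpoch_part].
  rewrite IH, pow_add, RtoC_mul; ring.
Qed.

Lemma qpoch_inf_add (z : Cx) (p : R) (m : nat) : 0 <= p < 1 ->
  qpoch_inf z p = (qpoch_part z p m * qpoch_inf (z * RtoC (p ^ m)) p)%Cx.
Proof.
intros hp; apply (C_cv_unique (fun n => qpoch_part z p (m + n)%nat)).
- apply C_cv_shift, qpoch_cv, hp.
- eapply C_cv_ext; [intros n; symmetry; apply qpoch_part_add|].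
  apply C_cv_mul; [apply C_cv_const|apply qpoch_cv, hp].
Qed.

(** A finite product divides the infinite one. Non-vanishing of infinite products is thus the one
    form of hypothesis from which the finite denominators are cleared. *)
Lemma qpoch_part_neq0 (z : Cx) (p : R) (n : nat) : 0 <= p < 1 ->
  qpoch_inf z p <> C0 -> qpoch_part z p n <> C0.
Proof.
intros hp h; rewrite (qpoch_inf_add z p n hp) in h; exact (Cmul_neq0_l _ _ h).
Qed.

Lemma qpoch_factor_neq0 (z : Cx) (p : R) (n : nat) : 0 <= p < 1 ->
  qpoch_inf z p <> C0 -> (C1 - z * RtoC (p ^ n))%Cx <> C0.
Proof.
intros hp h e; apply (qpoch_part_neq0 z p (S n) hp h); cbn [qpoch_part].
rewrite e; ring.
Qed.

Lemma qpoch_head_neq0 (z : Cx) (p : R) : 0 <= p < 1 ->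
  qpoch_inf z p <> C0 -> (C1 - z)%Cx <> C0.
Proof.
intros hp h; replace z with (z * RtoC (p ^ 0))%Cx.
- now apply qpoch_factor_neq0.
- simpl; change (RtoC 1) with C1; ring.
Qed.

(** Each factor satisfies [|1 - z p^k| >= 1 - |z| p^k >= exp (- c p^k)], so the partial products
    stay above the positive number [exp (- c / (1 - p))] and cannot tend to 0. *)
Lemma qpoch_inf_neq0 (z : Cx) (p : R) : 0 <= p < 1 -> Cnorm z < 1 ->
  qpoch_inf z p <> C0.
Proof.
intros hp hz h.
pose proof (Cnorm_ge0 z) as hz0.
(* This [c] solves [c - |z| = c |z|], whence [(1 - |z| t) (1 + c t) = 1 + c |z| t (1 - t) >= 1] for
   [0 <= t <= 1]. *)
set (c := Cnorm z / (1 - Cnorm z)).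
assert (hc : 0 <= c).
{ unfold c, Rdiv; apply Rmult_le_pos; [lra|left; apply Rinv_0_lt_compat; lra]. }
assert (hlow : forall n, exp (- (c / (1 - p))) <= Cnorm (qpoch_part z p n)).
{ intros n; apply Rle_trans with (exp (- (c * ((1 - p ^ n) / (1 - p))))).
  - apply exp_le_exp, Ropp_le_contravar; unfold Rdiv; apply Rmult_le_compat_l; [assumption|].
    pose proof (pow_le p n (proj1 hp)).
    rewrite <- (Rmult_1_l (/ (1 - p))) at 2.
    apply Rmult_le_compat_r; [left; apply Rinv_0_lt_compat|]; lra.
  - induction n as [|n IH]; cbn [qpoch_part].
    + rewrite Cnorm_C1; simpl.
      replace (- (c * ((1 - 1) / (1 - p)))) with 0 by (field; lra).
      rewrite exp_0; lra.
    + rewrite Cnorm_mul.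
      replace (- (c * ((1 - p ^ S n) / (1 - p))))
        with (- (c * ((1 - p ^ n) / (1 - p))) + - (c * p ^ n)) by (simpl; field; lra).
      rewrite exp_plus.
      apply Rmult_le_compat; [left; apply exp_pos|left; apply exp_pos|exact IH|].
      eapply Rle_trans; [|apply Cnorm_sub_ge].
      rewrite Cnorm_C1, Cnorm_mul, Cnorm_RtoC_pow by lra.
      assert (hpn : 0 <= p ^ n <= 1).
      { split; [apply pow_le; lra|]. rewrite <- (pow1 n); apply pow_incr; lra. }
      set (t := p ^ n) in *.
      assert (h1 : 1 <= (1 - Cnorm z * t) * (1 + c * t)).
      { apply Rle_trans with (1 + c * t * (Cnorm z * (1 - t))).
        - pose proof (Rmult_le_pos c t hc (proj1 hpn)).
          assert (0 <= Cnorm z * (1 - t)) by nra. nra.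
        - right; unfold c; field; lra. }
      rewrite exp_Ropp; apply (Rmult_le_reg_r (exp (c * t))); [apply exp_pos|].
      rewrite Rinv_l by (apply Rgt_not_eq, exp_pos).
      eapply Rle_trans; [exact h1|].
      apply Rmult_le_compat_l; [nra|apply exp_ineq1_le]. }
destruct (qpoch_cv z p hp (exp (- (c / (1 - p))))) as [N hN]; [apply exp_pos|].
specialize (hN N (le_n N)); rewrite h in hN.
replace (qpoch_part z p N - C0)%Cx with (qpoch_part z p N) in hN by ring.
specialize (hlow N); lra.
Qed.

(** * Bounds uniform in two indices *)

(** In the application the first index counts the shifts of [A] by [p] and the second is the
    summation index; one constant must serve for both. *)
Definition bounded2 (f : nat -> nat -> Cx) : Prop :=
  exists K, forall m n, Cnorm (f m n) <= K.

Lemma bounded2_ext (f g : nat -> nat -> Cx) :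
  (forall m n, f m n = g m n) -> bounded2 f -> bounded2 g.
Proof. intros e [K hK]; exists K; intros m n; rewrite <- e; auto. Qed.

Lemma bounded2_const (z : Cx) : bounded2 (fun _ _ => z).
Proof. exists (Cnorm z); intros; lra. Qed.

Lemma bounded2_mul (f g : nat -> nat -> Cx) :
  bounded2 f -> bounded2 g -> bounded2 (fun m n => f m n * g m n)%Cx.
Proof.
intros [K hK] [L hL]; exists (K * L); intros m n; rewrite Cnorm_mul.
apply Rmult_le_compat; auto using Cnorm_ge0.
Qed.

Lemma bounded2_sub (f g : nat -> nat -> Cx) :
  bounded2 f -> bounded2 g -> bounded2 (fun m n => f m n - g m n)%Cx.
Proof.
intros [K hK] [L hL]; exists (K + L); intros m n.
eapply Rle_trans; [apply Cnorm_sub_le|apply Rplus_le_compat; auto].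
Qed.

Lemma bounded2_pow (p : R) (k : nat -> nat -> nat) : 0 <= p < 1 ->
  bounded2 (fun m n => RtoC (p ^ k m n)).
Proof.
intros hp; exists 1; intros m n; rewrite Cnorm_RtoC_pow by lra.
rewrite <- (pow1 (k m n)); apply pow_incr; lra.
Qed.

Lemma bounded2_cv (u : nat -> Cx) (l : Cx) (k : nat -> nat -> nat) :
  C_cv u l -> bounded2 (fun m n => u (k m n)).
Proof. intros h; destruct (C_cv_bounded u l h) as [K hK]; exists K; auto. Qed.

(** The shifted product is the quotient of the partial products of lengths [m + k] and [m]. Both the
    numerators and the inverses of the denominators form convergent sequences, hence bounded
    ones. *)
Lemma bounded2_qpoch (z : Cx) (p : R) (k : nat -> nat -> nat) : 0 <= p < 1 ->
  qpoch_inf z p <> C0 ->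
  bounded2 (fun m n => qpoch_part (z * RtoC (p ^ m)) p (k m n)).
Proof.
intros hp hz.
eapply bounded2_ext; cycle 1.
- apply bounded2_mul.
  + apply (bounded2_cv _ _ (fun m n => (m + k m n)%nat) (qpoch_cv z p hp)).
  + apply (bounded2_cv _ _ (fun m n => m) (C_cv_inv _ _ (qpoch_cv z p hp) hz)).
- intros m n; simpl; rewrite qpoch_part_add.
  field; now apply qpoch_part_neq0.
Qed.

Lemma qpoch_inf_shift_neq0 (z : Cx) (p : R) (m : nat) : 0 <= p < 1 ->
  qpoch_inf z p <> C0 -> qpoch_inf (z * RtoC (p ^ m)) p <> C0.
Proof.
intros hp hz e; apply hz; rewrite (qpoch_inf_add z p m hp), e; ring.
Qed.

Lemma bounded2_qpoch_inv (z : Cx) (p : R) (k : nat -> nat -> nat) : 0 <= p < 1 ->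
  qpoch_inf z p <> C0 ->
  bounded2 (fun m n => / qpoch_part (z * RtoC (p ^ m)) p (k m n))%Cx.
Proof.
intros hp hz.
eapply bounded2_ext; cycle 1.
- apply bounded2_mul.
  + apply (bounded2_cv _ _ (fun m n => m) (qpoch_cv z p hp)).
  + apply (bounded2_cv _ _ (fun m n => (m + k m n)%nat)
             (C_cv_inv _ _ (qpoch_cv z p hp) hz)).
- intros m n; simpl; rewrite qpoch_part_add.
  field; split; apply qpoch_part_neq0; auto using qpoch_inf_shift_neq0.
Qed.

(** A single factor is a shifted product of length 1. *)
Lemma bounded2_factor_inv (z : Cx) (p : R) : 0 <= p < 1 ->
  qpoch_inf z p <> C0 -> bounded2 (fun m _ => / (C1 - z * RtoC (p ^ m)))%Cx.
Proof.
intros hp hz; apply (bounded2_ext _ _) with (2 := bounded2_qpoch_inv z p (fun _ _ => 1%nat) hp hz).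
intros m n; cbn [qpoch_part]; simpl; f_equal; change (RtoC 1) with C1; ring.
Qed.

Lemma qpoch_inf_base_neq0 (p : R) : 0 <= p < 1 -> qpoch_inf (RtoC p) p <> C0.
Proof.
intros hp; apply qpoch_inf_neq0; [assumption|rewrite Cnorm_RtoC, Rabs_pos_eq; lra].
Qed.

(** * Rogers' 6phi5 sum *)

Fixpoint Cx_pow (z : Cx) (n : nat) : Cx :=
  match n with O => C1 | S m => (Cx_pow z m * z)%Cx end.

Lemma Cnorm_pow (z : Cx) (n : nat) : Cnorm (Cx_pow z n) = Cnorm z ^ n.
Proof.
induction n as [|n IH]; simpl; [apply Cnorm_C1|rewrite Cnorm_mul, IH; ring].
Qed.

Lemma Cx_pow_mul (z w : Cx) (n : nat) :
  Cx_pow (z * w) n = (Cx_pow z n * Cx_pow w n)%Cx.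
Proof. induction n as [|n IH]; simpl; [|rewrite IH]; ring. Qed.

Lemma Cx_pow_RtoC (x : R) (n : nat) : Cx_pow (RtoC x) n = RtoC (x ^ n).
Proof. induction n as [|n IH]; simpl; [reflexivity|rewrite IH, <- RtoC_mul; f_equal; ring]. Qed.

(** Both sides are the product of length [n + 1] started at [z]; cross-multiplying avoids a division
    by [1 - z]. *)
Lemma qpoch_part_shift (z : Cx) (p : R) (n : nat) :
  (qpoch_part (z * RtoC p) p n * (C1 - z))%Cx =
  (qpoch_part z p n * (C1 - z * RtoC (p ^ n)))%Cx.
Proof.
induction n as [|n IH]; cbn [qpoch_part].
- simpl; change (RtoC 1) with C1; ring.
- transitivity (qpoch_part (z * RtoC p) p n * (C1 - z) * (C1 - z * RtoC p * RtoC (p ^ n)))%Cx;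
    [ring|rewrite IH; simpl; rewrite RtoC_mul; ring].
Qed.

(* [E], [F], [G], [z] stand for [Ap/B], [Ap/C], [Ap/D], [Ap/(BCD)]. *)
Definition phi65_weight (p : R) (A B C D E F G z : Cx) (n : nat) : Cx :=
  ((qpoch_part A p n * qpoch_part B p n * qpoch_part C p n * qpoch_part D p n)
   / ((C1 - A) * (qpoch_part (RtoC p) p n * qpoch_part E p n
      * qpoch_part F p n * qpoch_part G p n)) * Cx_pow z n)%Cx.

(** The very-well-poised factor is kept apart from the weight, so that the telescoping certificate,
    a multiple of the weight, does not divide by it. *)
Definition phi65_term (p : R) (A B C D E F G z : Cx) (n : nat) : Cx :=
  ((C1 - A * RtoC (p ^ n) * RtoC (p ^ n)) * phi65_weight p A B C D E F G z n)%Cx.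

(** With the next lemma, this writes the weights at [n + 1] and at the shifted [A] as one common
    weight times rational functions of [p^n]. *)
Lemma phi65_weight_S (p : R) (A B C D E F G z : Cx) (n : nat) :
  0 <= p < 1 -> (C1 - A)%Cx <> C0 ->
  qpoch_inf E p <> C0 -> qpoch_inf F p <> C0 -> qpoch_inf G p <> C0 ->
  phi65_weight p A B C D E F G z (S n) =
  (phi65_weight p A B C D E F G z n *
   (z * (C1 - A * RtoC (p ^ n)) * (C1 - B * RtoC (p ^ n)) *
    (C1 - C * RtoC (p ^ n)) * (C1 - D * RtoC (p ^ n)) /
    ((C1 - RtoC p * RtoC (p ^ n)) * (C1 - E * RtoC (p ^ n)) *
     (C1 - F * RtoC (p ^ n)) * (C1 - G * RtoC (p ^ n)))))%Cx.
Proof.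
intros hp hA hE hF hG.
pose proof (qpoch_inf_base_neq0 p hp) as hP.
unfold phi65_weight; cbn [qpoch_part Cx_pow].
field; repeat split; auto using qpoch_part_neq0, qpoch_factor_neq0.
Qed.

(** Replacing [A] by [Ap] with [B], [C], [D] fixed multiplies each of [E], [F], [G], [z] by [p]. *)
Lemma phi65_weight_shift (p : R) (A B C D E F G z : Cx) (n : nat) :
  0 <= p < 1 -> qpoch_inf A p <> C0 ->
  qpoch_inf E p <> C0 -> qpoch_inf F p <> C0 -> qpoch_inf G p <> C0 ->
  phi65_weight p (A * RtoC p) B C D (E * RtoC p) (F * RtoC p) (G * RtoC p)
    (z * RtoC p) n =
  (phi65_weight p A B C D E F G z n *
   ((C1 - A * RtoC (p ^ n)) * (C1 - E) * (C1 - F) * (C1 - G) * RtoC (p ^ n) /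
    ((C1 - A * RtoC p) * (C1 - E * RtoC (p ^ n)) *
     (C1 - F * RtoC (p ^ n)) * (C1 - G * RtoC (p ^ n)))))%Cx.
Proof.
intros hp hA hE hF hG.
pose proof (qpoch_inf_base_neq0 p hp) as hP.
pose proof (fun y => qpoch_head_neq0 y p hp) as h1.
assert (hp1 : forall y, qpoch_inf y p <> C0 -> (C1 - y * RtoC p)%Cx <> C0).
{ intros y hy; generalize (qpoch_factor_neq0 y p 1 hp hy); now rewrite pow_1. }
assert (hs : forall y, qpoch_inf y p <> C0 -> qpoch_part (y * RtoC p) p n =
          (qpoch_part y p n * (C1 - y * RtoC (p ^ n)) / (C1 - y))%Cx).
{ intros y hy; rewrite <- qpoch_part_shift; field; auto. }
unfold phi65_weight; rewrite Cx_pow_mul, Cx_pow_RtoC, !hs by assumption.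
field; repeat split; auto using qpoch_part_neq0, qpoch_factor_neq0.
Qed.

Lemma Cinv_inv (z : Cx) : z <> C0 -> (/ / z)%Cx = z.
Proof. intros hz; field; split; [assumption|apply C1_neq0]. Qed.

(* The inverses of [B], [C], [D] are the variables, so that the nonvanishing
   conditions keep the form [1 - y <> 0]. *)
Lemma phi65_certificate_algebra (A P x w u v t E F G z : Cx) :
  u <> C0 -> v <> C0 -> t <> C0 ->
  E = (A * P * u)%Cx -> F = (A * P * v)%Cx -> G = (A * P * t)%Cx ->
  z = (A * P * u * v * t)%Cx ->
  (C1 - z)%Cx <> C0 -> (C1 - A * P)%Cx <> C0 ->
  (C1 - E)%Cx <> C0 -> (C1 - F)%Cx <> C0 -> (C1 - G)%Cx <> C0 ->
  (C1 - P * x)%Cx <> C0 ->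
  (C1 - E * x)%Cx <> C0 -> (C1 - F * x)%Cx <> C0 -> (C1 - G * x)%Cx <> C0 ->
  ((C1 - A * x * x) * w
   - (C1 - A * P) * (C1 - z * / u) * (C1 - z * / v) * (C1 - z * / t)
     / ((C1 - E) * (C1 - F) * (C1 - G) * (C1 - z))
     * ((C1 - A * P * x * x) *
        (w * ((C1 - A * x) * (C1 - E) * (C1 - F) * (C1 - G) * x /
           ((C1 - A * P) * (C1 - E * x) * (C1 - F * x) * (C1 - G * x))))))%Cx
  = (- (w * (z * (C1 - A * x) * (C1 - / u * x) * (C1 - / v * x) * (C1 - / t * x) /
          ((C1 - P * x) * (C1 - E * x) * (C1 - F * x) * (C1 - G * x)))
        * ((C1 - P * x) * (C1 - A * z * (P * x)) / (C1 - z)))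
     - - (w * ((C1 - x) * (C1 - A * z * x) / (C1 - z))))%Cx.
Proof.
intros hu hv ht -> -> -> ->; intros.
field.
repeat split; assumption.
Qed.

(** Once the common weight is extracted, this is an identity of rational functions of [p^n]. The
    coefficient of the shifted term is the ratio of the values of Rogers' product at [A] and at
    [Ap]. *)
Lemma phi65_certificate (p : R) (A B C D E F G z : Cx) (n : nat) :
  0 <= p < 1 -> B <> C0 -> C <> C0 -> D <> C0 ->
  E = (A * RtoC p / B)%Cx -> F = (A * RtoC p / C)%Cx -> G = (A * RtoC p / D)%Cx ->
  z = (A * RtoC p / (B * C * D))%Cx ->
  qpoch_inf A p <> C0 ->
  qpoch_inf E p <> C0 -> qpoch_inf F p <> C0 -> qpoch_inf G p <> C0 ->
  (C1 - z)%Cx <> C0 ->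
  let g n := (- (phi65_weight p A B C D E F G z n *
     ((C1 - RtoC (p ^ n)) * (C1 - A * z * RtoC (p ^ n)) / (C1 - z))))%Cx in
  (phi65_term p A B C D E F G z n
   - (C1 - A * RtoC p) * (C1 - z * B) * (C1 - z * C) * (C1 - z * D)
     / ((C1 - E) * (C1 - F) * (C1 - G) * (C1 - z))
     * phi65_term p (A * RtoC p) B C D (E * RtoC p) (F * RtoC p) (G * RtoC p)
         (z * RtoC p) n)%Cx
  = (g (S n) - g n)%Cx.
Proof.
intros hp hB hC hD eE eF eG ez hA hE hF hG hz g.
pose proof (qpoch_inf_base_neq0 p hp) as hP.
pose proof (fun y => qpoch_head_neq0 y p hp) as h1.
assert (hp1 : (C1 - A * RtoC p)%Cx <> C0).
{ generalize (qpoch_factor_neq0 A p 1 hp hA); now rewrite pow_1. }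
unfold g, phi65_term.
rewrite phi65_weight_shift, phi65_weight_S by auto.
replace (RtoC (p ^ S n)) with (RtoC p * RtoC (p ^ n))%Cx by (simpl; now rewrite RtoC_mul).
generalize (h1 E hE) (h1 F hF) (h1 G hG) (qpoch_factor_neq0 _ p n hp hP)
  (qpoch_factor_neq0 E p n hp hE) (qpoch_factor_neq0 F p n hp hF)
  (qpoch_factor_neq0 G p n hp hG).
intros; rewrite <- (Cinv_inv B), <- (Cinv_inv C), <- (Cinv_inv D) by assumption.
apply phi65_certificate_algebra; auto using Cinv_neq0; try (subst; field; auto).
Qed.

(** [r] does not depend on [n], so it factors out of the sum. [Csum] stops before index [N], which
    makes the upper boundary term exactly [g N]. *)
Lemma Csum_telescope (u v g : nat -> Cx) (r : Cx) (N : nat) :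
  (forall n, u n - r * v n = g (S n) - g n)%Cx -> g 0%nat = C0 ->
  (Csum u N - r * Csum v N)%Cx = g N.
Proof.
intros h h0; induction N as [|N IH]; simpl; [rewrite h0; ring|].
transitivity ((Csum u N - r * Csum v N) + (u N - r * v N))%Cx; [ring|].
rewrite IH, h; ring.
Qed.

Lemma Csum_scal (u : nat -> Cx) (k : Cx) (N : nat) :
  Csum (fun n => k * u n)%Cx N = (k * Csum u N)%Cx.
Proof. induction N as [|N IH]; simpl; [|rewrite IH]; ring. Qed.

Lemma Csum_ext (u v : nat -> Cx) (N : nat) : (forall n, u n = v n) -> Csum u N = Csum v N.
Proof. intros h; induction N as [|N IH]; simpl; [|rewrite IH, h]; reflexivity. Qed.

Lemma C_cv_Csum (u : nat -> nat -> Cx) (l : nat -> Cx) (N : nat) :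
  (forall n, C_cv (fun m => u m n) (l n)) -> C_cv (fun m => Csum (u m) N) (Csum l N).
Proof.
intros h; induction N as [|N IH]; simpl; [apply C_cv_const|now apply C_cv_add].
Qed.

Lemma C_cv_0_of_le (u : nat -> Cx) (K r : R) : 0 <= r < 1 ->
  (forall n, Cnorm (u n) <= K * r ^ n) -> C_cv u C0.
Proof.
intros hr h eps he.
assert (hK : 0 <= K).
{ pose proof (h 0%nat) as h0; pose proof (Cnorm_ge0 (u 0%nat)); simpl in h0; lra. }
destruct (pow_small K r eps hK hr he) as [N hN]; exists N; intros n hn.
replace (u n - C0)%Cx with (u n) by ring.
eapply Rle_lt_trans; [apply h|auto].
Qed.

(** The condition [Cnorm z < 1] acts twice: it makes [qpoch_inf z p] nonzero, and it makes the error
    of the partial sums tend to 0. *)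
Theorem rogers_6phi5 (p : R) (A B C D E F G z : Cx) :
  0 <= p < 1 -> B <> C0 -> C <> C0 -> D <> C0 ->
  E = (A * RtoC p / B)%Cx -> F = (A * RtoC p / C)%Cx -> G = (A * RtoC p / D)%Cx ->
  z = (A * RtoC p / (B * C * D))%Cx -> Cnorm z < 1 ->
  qpoch_inf A p <> C0 ->
  qpoch_inf E p <> C0 -> qpoch_inf F p <> C0 -> qpoch_inf G p <> C0 ->
  C_cv (Csum (phi65_term p A B C D E F G z))
    (qpoch_inf (A * RtoC p) p * qpoch_inf (z * B) p * qpoch_inf (z * C) p
       * qpoch_inf (z * D) p
     / (qpoch_inf E p * qpoch_inf F p * qpoch_inf G p * qpoch_inf z p))%Cx.
Proof.
intros hp hB hC hD eE eF eG ez hz hA hE hF hG.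
pose proof (qpoch_inf_base_neq0 p hp) as hP.
assert (hZ : qpoch_inf z p <> C0) by now apply qpoch_inf_neq0.
(* [X y m] is the parameter [y] after [m] shifts; [w], [T] and [g] are the weight, term and
   certificate after [m] shifts. *)
pose (X := fun (y : Cx) (m : nat) => (y * RtoC (p ^ m))%Cx).
assert (hX0 : forall y, X y 0%nat = y).
{ intros y; unfold X; simpl; change (RtoC 1) with C1; ring. }
assert (hXS : forall y m, X y (S m) = (X y m * RtoC p)%Cx).
{ intros y m; unfold X; simpl; rewrite RtoC_mul; ring. }
assert (hXn : forall y m, qpoch_inf y p <> C0 -> qpoch_inf (X y m) p <> C0).
{ intros; now apply qpoch_inf_shift_neq0. }
pose (w := fun m => phi65_weight p (X A m) B C D (X E m) (X F m) (X G m) (X z m)).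
pose (T := fun m => phi65_term p (X A m) B C D (X E m) (X F m) (X G m) (X z m)).
pose (g := fun m n => (- (w m n * ((C1 - RtoC (p ^ n)) * (C1 - X A m * X z m * RtoC (p ^ n))
                                  / (C1 - X z m))))%Cx).
(* [Q m] is the product of the first [m] ratios, that is, the partial product of the claimed value
   [L]. *)
pose (Q := fun m => (qpoch_part (A * RtoC p) p m * qpoch_part (z * B) p m
                   * qpoch_part (z * C) p m * qpoch_part (z * D) p m
     / (qpoch_part E p m * qpoch_part F p m * qpoch_part G p m * qpoch_part z p m))%Cx).
set (L := (_ / _)%Cx).
assert (hQ : C_cv Q L).
{ apply C_cv_div; [repeat apply C_cv_mul; now apply qpoch_cv..|].
  repeat apply Cmul_neq0; assumption. }
assert (hf : forall y m, qpoch_inf y p <> C0 -> (C1 - X y m)%Cx <> C0).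
{ intros; now apply qpoch_factor_neq0. }
(* The telescoped identity at shift [m], multiplied by [Q m]: the increments in [m] of
   [Q m * Csum (T m) N] are the boundary terms. *)
assert (hrec : forall m N,
  (Q m * Csum (T m) N - Q (S m) * Csum (T (S m)) N = Q m * g m N)%Cx).
{ intros m N.
  pose (r := ((C1 - X A m * RtoC p) * (C1 - X z m * B) * (C1 - X z m * C) * (C1 - X z m * D)
      / ((C1 - X E m) * (C1 - X F m) * (C1 - X G m) * (C1 - X z m)))%Cx).
  assert (hQS : Q (S m) = (Q m * r)%Cx).
  { unfold Q, r, X; cbn [qpoch_part].
    field; repeat split; auto using qpoch_part_neq0, qpoch_factor_neq0. }
  assert (ht : (Csum (T m) N - r * Csum (T (S m)) N)%Cx = g m N).
  { apply Csum_telescope.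
    - intros n; unfold T; rewrite !hXS.
      apply phi65_certificate; auto; subst; unfold X; field; auto.
    - unfold g; simpl; change (RtoC 1) with C1; field; auto. }
  rewrite <- ht, hQS; ring. }
assert (hQ0 : Q 0%nat = C1) by (unfold Q; simpl; field; apply C1_neq0).
(* From here on [Q] enters only through its limit, its recurrence and its value at 0. *)
clearbody Q.
(* All the shifted factorials are bounded uniformly in [m] and [n]; only the power of [z p^m]
   carries decay. *)
assert (hw : exists K, 0 <= K /\ forall m n, Cnorm (w m n) <= K * (Cnorm z * p ^ m) ^ n).
{ assert (hb : bounded2 (fun m n => (qpoch_part (X A m) p n * qpoch_part B p n
      * qpoch_part C p n * qpoch_part D p n
      * (/ (C1 - X A m) * / qpoch_part (RtoC p) p n * / qpoch_part (X E m) p n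
      * / qpoch_part (X F m) p n * / qpoch_part (X G m) p n))%Cx)).
  { repeat apply bounded2_mul; unfold X.
    - now apply (bounded2_qpoch A p (fun _ n => n)).
    - exact (bounded2_cv _ _ (fun _ n => n) (qpoch_cv _ p hp)).
    - exact (bounded2_cv _ _ (fun _ n => n) (qpoch_cv _ p hp)).
    - exact (bounded2_cv _ _ (fun _ n => n) (qpoch_cv _ p hp)).
    - now apply bounded2_factor_inv.
    - apply (bounded2_cv _ _ (fun _ n => n) (C_cv_inv _ _ (qpoch_cv _ p hp) hP)).
    - now apply (bounded2_qpoch_inv E p (fun _ n => n)).
    - now apply (bounded2_qpoch_inv F p (fun _ n => n)).
    - now apply (bounded2_qpoch_inv G p (fun _ n => n)). }
  destruct hb as [K hK]; exists K; split.
  { eapply Rle_trans; [apply Cnorm_ge0|apply (hK 0%nat 0%nat)]. }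
  intros m n; unfold w, phi65_weight.
  rewrite Cnorm_mul, Cnorm_pow.
  (* The sixth occurrence is [X z m], the base of the power. *)
  unfold X at 6; rewrite Cnorm_mul, Cnorm_RtoC_pow by lra.
  apply Rmult_le_compat_r.
  { apply pow_le, Rmult_le_pos; [apply Cnorm_ge0|apply pow_le; lra]. }
  eapply Rle_trans; [right|apply (hK m n)]; f_equal.
  field; repeat split; auto using qpoch_part_neq0. }
destruct hw as [K [hK0 hK]].
(* For [n >= 1] the factor [(p^m)^n] is at most [p^m]. *)
assert (hwS : forall m n, Cnorm (w m (S n)) <= K * Cnorm z ^ S n * p ^ m).
{ intros m n; eapply Rle_trans; [apply hK|].
  rewrite Rpow_mult_distr, <- Rmult_assoc.
  apply Rmult_le_compat_l; [apply Rmult_le_pos; [assumption|apply pow_le, Cnorm_ge0]|].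
  assert (hpm : 0 <= p ^ m <= 1).
  { split; [apply pow_le; lra|]. rewrite <- (pow1 m); apply pow_incr; lra. }
  assert (0 <= (p ^ m) ^ n <= 1).
  { split; [apply pow_le; lra|]. rewrite <- (pow1 n); apply pow_incr; lra. }
  simpl; nra. }
(* The term of index 0 is identically 1 and each later one is [O(p^m)]. The length is [S N] because
   the empty sum would tend to 0 instead of 1. *)
assert (hT : forall N, C_cv (fun m => Csum (T m) (S N)) C1).
{ intros N.
  assert (hl : Csum (fun n => match n with O => C1 | _ => C0 end) (S N) = C1).
  { induction N as [|N IH]; [simpl; ring|].
    cbn [Csum] in *; rewrite IH; ring. }
  rewrite <- hl; apply C_cv_Csum; intros [|n].
  - apply (C_cv_ext (fun _ => C1)); [|apply C_cv_const].
    intros m; unfold T, phi65_term, phi65_weight; simpl; change (RtoC 1) with C1.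
    field; auto using C1_neq0.
  - assert (hb : bounded2 (fun m n => C1 - A * (RtoC (p ^ m) * (RtoC (p ^ n) * RtoC (p ^ n))))%Cx).
    { repeat first [apply bounded2_sub | apply bounded2_mul | apply bounded2_const].
      - now apply (bounded2_pow p (fun m _ => m)).
      - now apply (bounded2_pow p (fun _ n => n)).
      - now apply (bounded2_pow p (fun _ n => n)). }
    destruct hb as [M hM].
    apply (C_cv_0_of_le _ (M * (K * Cnorm z ^ S n)) p hp).
    intros m; unfold T, phi65_term; fold (w m).
    rewrite Cnorm_mul, Rmult_assoc.
    apply Rmult_le_compat; try apply Cnorm_ge0; [|apply hwS].
    eapply Rle_trans; [right|apply (hM m (S n))]; f_equal; unfold X; ring. }
(* The factor [p^m] makes the increments summable over [m], while the power of [|z|] survives as the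
   final error. *)
assert (hg : exists M, forall m n, Cnorm (Q m * g m (S n)) <= M * Cnorm z ^ S n * p ^ m).
{ assert (hb : bounded2 (fun m n => Q m * ((C1 - RtoC (p ^ n))
      * (C1 - A * RtoC (p ^ m) * (z * RtoC (p ^ m)) * RtoC (p ^ n)) * / (C1 - X z m)))%Cx).
  { repeat first [apply bounded2_sub | apply bounded2_mul | apply bounded2_const];
      try now apply (bounded2_pow p (fun m _ => m)).
    - apply (bounded2_cv _ _ (fun m _ => m) hQ).
    - now apply (bounded2_pow p (fun _ n => n)).
    - now apply (bounded2_pow p (fun _ n => n)).
    - now apply bounded2_factor_inv. }
  destruct hb as [M hM]; exists (M * K); intros m n.
  replace (Q m * g m (S n))%Cx with (- ((Q m * ((C1 - RtoC (p ^ S n))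
      * (C1 - A * RtoC (p ^ m) * (z * RtoC (p ^ m)) * RtoC (p ^ S n))
      * / (C1 - X z m))) * w m (S n)))%Cx
    by (unfold g, X; field; now apply hf).
  rewrite Cnorm_opp, Cnorm_mul, !Rmult_assoc, <- (Rmult_assoc K).
  apply Rmult_le_compat; auto using Cnorm_ge0. }
destruct hg as [M hM].
(* The sequence [Q m * Csum (T m) (S N)] starts at the partial sum sought and tends to [L], so the
   summed increments bound their distance. *)
assert (hfin : forall N, Cnorm (L - Csum (T 0%nat) (S N)) <= M / (1 - p) * Cnorm z ^ S N).
{ intros N.
  assert (hU : C_cv (fun m => Q m * Csum (T m) (S N))%Cx (L * C1)%Cx)
    by (apply C_cv_mul; auto).
  replace (L * C1)%Cx with L in hU by ring.
  apply (C_cv_norm_le _ _ _ _ hU); intros m.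
  replace (Csum (T 0%nat) (S N)) with (Q 0%nat * Csum (T 0%nat) (S N))%Cx
    by (rewrite hQ0; ring).
  pose proof (C_cv_geometric_bound (fun m => Q m * Csum (T m) (S N))%Cx
    (M * Cnorm z ^ S N) p hp) as hb.
  eapply Rle_trans; [apply (hb ltac:(intros i; cbv beta; rewrite hrec; apply hM) 0%nat m)|].
  right; simpl; field; lra. }
intros eps he.
(* No sign is known for [M], hence the absolute value. *)
destruct (pow_small (Rabs (M / (1 - p))) (Cnorm z) eps) as [N hN];
  [apply Rabs_pos|split; [apply Cnorm_ge0|assumption]|assumption|].
exists (S N); intros [|n] hn; [lia|].
replace (Csum (phi65_term p A B C D E F G z) (S n)) with (Csum (T 0%nat) (S n))
  by (unfold T; now rewrite !hX0).
rewrite <- Cnorm_opp.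
replace (- (Csum (T 0%nat) (S n) - L))%Cx with (L - Csum (T 0%nat) (S n))%Cx by ring.
eapply Rle_lt_trans; [apply hfin|].
eapply Rle_lt_trans; [|apply (hN (S n)); lia].
apply Rmult_le_compat_r; [apply pow_le, Cnorm_ge0|apply Rle_abs].
Qed.

(** * The q-gamma function *)

Lemma Cexp_add (z w : Cx) : Cexp (z + w) = (Cexp z * Cexp w)%Cx.
Proof.
apply Cx_ext; simpl; rewrite exp_plus; [rewrite cos_plus|rewrite sin_plus]; ring.
Qed.

Lemma Cpow_add (q : R) (x y : Cx) : Cpow q (x + y) = (Cpow q x * Cpow q y)%Cx.
Proof. unfold Cpow; rewrite <- Cexp_add; f_equal; ring. Qed.

Lemma Cpow_0 (q : R) : Cpow q C0 = C1.
Proof.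
unfold Cpow; replace (C0 * RtoC (ln q))%Cx with C0 by ring.
apply Cx_ext; simpl; rewrite exp_0, ?cos_0, ?sin_0; ring.
Qed.

Lemma Cpow_neq0 (q : R) (x : Cx) : Cpow q x <> C0.
Proof.
apply (Cmul_neq0_l _ (Cpow q (- x))); rewrite <- Cpow_add.
replace (x + - x)%Cx with C0 by ring; rewrite Cpow_0; apply C1_neq0.
Qed.

Lemma Cpow_sub (q : R) (x y : Cx) : Cpow q (x - y) = (Cpow q x / Cpow q y)%Cx.
Proof.
replace (Cpow q x) with (Cpow q (x - y + y)%Cx) by (f_equal; ring).
rewrite Cpow_add; field; apply Cpow_neq0.
Qed.

Lemma Cpow_RtoC (q x : R) : Cpow q (RtoC x) = RtoC (Rpower q x).
Proof.
unfold Cpow, Rpower; rewrite <- RtoC_mul.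
apply Cx_ext; simpl; [rewrite cos_0|rewrite sin_0]; ring.
Qed.

Lemma Cpow_C1 (q : R) : 0 < q -> Cpow q C1 = RtoC q.
Proof. intros hq; unfold C1; rewrite Cpow_RtoC, Rpower_1; auto. Qed.

Lemma CN_S (n : nat) : CN (S n) = (CN n + C1)%Cx.
Proof. unfold CN, C1; now rewrite S_INR, RtoC_add. Qed.

Lemma Cpow_mul_CN (q : R) (x : Cx) (n : nat) :
  Cpow q (x * CN n) = Cx_pow (Cpow q x) n.
Proof.
induction n as [|n IH]; cbn [Cx_pow].
- replace (x * CN 0)%Cx with C0 by (change (CN 0) with C0; ring); apply Cpow_0.
- rewrite CN_S, <- IH, <- Cpow_add; f_equal; ring.
Qed.

Lemma Cnorm_Cexp (z : Cx) : Cnorm (Cexp z) = exp (Re z).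
Proof.
unfold Cnorm; simpl.
replace (_ + _) with (Rsqr (exp (Re z)) * (Rsqr (sin (Im z)) + Rsqr (cos (Im z))))
  by (unfold Rsqr; ring).
rewrite sin2_cos2, Rmult_1_r; apply sqrt_Rsqr; left; apply exp_pos.
Qed.

Lemma Cnorm_Cpow (q : R) (x : Cx) : Cnorm (Cpow q x) = Rpower q (Re x).
Proof. unfold Cpow, Rpower; rewrite Cnorm_Cexp; f_equal; simpl; ring. Qed.

(** Turns additive relations between gamma arguments into multiplicative relations between the
    parameters of Rogers' sum. *)
Definition qexp2 (q : R) (x : Cx) : Cx := Cpow q (RtoC 2 * x).

Lemma qexp2_add (q : R) (x y : Cx) : qexp2 q (x + y) = (qexp2 q x * qexp2 q y)%Cx.
Proof. unfold qexp2; rewrite <- Cpow_add; f_equal; ring. Qed.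

Lemma qexp2_sub (q : R) (x y : Cx) : qexp2 q (x - y) = (qexp2 q x / qexp2 q y)%Cx.
Proof. unfold qexp2; rewrite <- Cpow_sub; f_equal; ring. Qed.

Lemma qexp2_neq0 (q : R) (x : Cx) : qexp2 q x <> C0.
Proof. apply Cpow_neq0. Qed.

Lemma qexp2_C1 (q : R) : 0 < q -> qexp2 q C1 = RtoC (q ^ 2).
Proof.
intros hq; unfold qexp2; replace (RtoC 2 * C1)%Cx with (C1 + C1)%Cx
  by (apply Cx_ext; simpl; ring).
rewrite Cpow_add, Cpow_C1, <- RtoC_mul by assumption; f_equal; ring.
Qed.

Lemma qexp2_half (q : R) : 0 < q -> qexp2 q Chalf = RtoC q.
Proof.
intros hq; unfold qexp2; replace (RtoC 2 * Chalf)%Cx with C1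
  by (apply Cx_ext; simpl; field).
now apply Cpow_C1.
Qed.

Lemma qexp2_CN (q : R) (n : nat) : 0 < q -> qexp2 q (CN n) = RtoC ((q ^ 2) ^ n).
Proof.
intros hq; unfold qexp2; rewrite Cpow_mul_CN, <- Cx_pow_RtoC.
f_equal; rewrite <- qexp2_C1 by assumption; unfold qexp2; f_equal; ring.
Qed.

Lemma Cpow_add_CN (q : R) (x : Cx) (n : nat) : 0 < q ->
  Cpow q (x + CN n) = (Cpow q x * RtoC (q ^ n))%Cx.
Proof.
intros hq; rewrite Cpow_add; f_equal.
replace (CN n) with (C1 * CN n)%Cx by ring.
now rewrite Cpow_mul_CN, Cpow_C1, Cx_pow_RtoC.
Qed.

Lemma base_bounds (q : R) : 0 < q < 1 ->
  0 <= q ^ 2 < 1.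
Proof. intros hq; simpl; nra. Qed.

Lemma one_sub_base_neq0 (q : R) : 0 < q < 1 ->
  RtoC (1 - q ^ 2) <> C0.
Proof. intros hq; pose proof (base_bounds q hq); apply RtoC_neq0; lra. Qed.

Lemma qGamma2_defined_iff (q : R) (x : Cx) :
  qGamma2_defined q x <-> qpoch_inf (qexp2 q x) (q ^ 2) <> C0.
Proof. reflexivity. Qed.

(** The power with exponent [1 - x] is split into a quotient so that [field] can cancel powers. *)
Lemma qGamma2_eq (q : R) (x : Cx) : 0 < q < 1 ->
  qGamma2 q x = (qpoch_inf (RtoC (q ^ 2)) (q ^ 2) / qpoch_inf (qexp2 q x) (q ^ 2)
                 * (RtoC (1 - q ^ 2) / Cpow (1 - q ^ 2) x))%Cx.
Proof.
intros hq; pose proof (base_bounds q hq).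
unfold qGamma2; rewrite Cpow_sub, Cpow_C1 by lra; reflexivity.
Qed.

Lemma qGamma2_neq0 (q : R) (x : Cx) : 0 < q < 1 ->
  qGamma2_defined q x -> qGamma2 q x <> C0.
Proof.
intros hq hx; rewrite qGamma2_eq by assumption.
repeat apply Cmul_neq0; auto using Cinv_neq0, Cpow_neq0, qpoch_inf_base_neq0,
  one_sub_base_neq0, base_bounds.
Qed.

Lemma qGamma2_C1_defined (q : R) : 0 < q < 1 ->
  qGamma2_defined q C1.
Proof.
intros hq; rewrite qGamma2_defined_iff, qexp2_C1 by lra.
now apply qpoch_inf_base_neq0, base_bounds.
Qed.

Lemma qGamma2_half_defined (q : R) : 0 < q < 1 ->
  qGamma2_defined q Chalf.
Proof.
intros hq; rewrite qGamma2_defined_iff, qexp2_half by lra.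
apply qpoch_inf_neq0; [now apply base_bounds|rewrite Cnorm_RtoC, Rabs_pos_eq; lra].
Qed.

(** The functional equation iterated [n] times: the infinite product at [x + n] is a tail of the one
    at [x]. *)
Lemma qGamma2_add_CN (q : R) (x : Cx) (n : nat) : 0 < q < 1 ->
  qGamma2_defined q x ->
  qGamma2 q (x + CN n) =
  (qGamma2 q x * (qpoch_part (qexp2 q x) (q ^ 2) n / RtoC ((1 - q ^ 2) ^ n)))%Cx.
Proof.
intros hq hx; pose proof (base_bounds q hq) as hp.
rewrite qGamma2_defined_iff in hx.
rewrite !qGamma2_eq, qexp2_add, qexp2_CN, Cpow_add_CN by lra.
rewrite (qpoch_inf_add (qexp2 q x) (q ^ 2) n hp).
field; repeat split; auto using Cpow_neq0, qpoch_part_neq0, qpoch_inf_shift_neq0.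
apply RtoC_neq0, pow_nonzero; lra.
Qed.

Lemma qshift2_eq (q : R) (x y alpha : Cx) : (x + alpha)%Cx = y ->
  qshift2 q x alpha = (qGamma2 q y / qGamma2 q x)%Cx.
Proof. intros <-; reflexivity. Qed.

Lemma qshift2_neq0 (q : R) (x alpha : Cx) : 0 < q < 1 ->
  qGamma2_defined q x -> qGamma2_defined q (x + alpha) -> qshift2 q x alpha <> C0.
Proof. intros hq; intros; apply Cdiv_neq0; now apply qGamma2_neq0. Qed.

(** Isolates the dependence on [n]; stating [beta] by an equation accommodates the different
    groupings in the summand. *)
Lemma qshift2_add_CN (q : R) (x alpha beta : Cx) (n : nat) : 0 < q < 1 ->
  beta = (alpha + CN n)%Cx ->
  qGamma2_defined q x -> qGamma2_defined q (x + alpha) ->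
  qshift2 q x beta =
  (qshift2 q x alpha * (qpoch_part (qexp2 q (x + alpha)) (q ^ 2) n
                       / RtoC ((1 - q ^ 2) ^ n)))%Cx.
Proof.
intros hq -> hx ha; unfold qshift2.
replace (x + (alpha + CN n))%Cx with (x + alpha + CN n)%Cx by ring.
rewrite qGamma2_add_CN by assumption.
field; split; [|now apply qGamma2_neq0].
apply RtoC_neq0, pow_nonzero; pose proof (base_bounds q hq); lra.
Qed.

Lemma RtoC_qfact2 (q : R) (n : nat) : 0 < q < 1 ->
  RtoC (qfact2 q n) =
  (qpoch_part (RtoC (q ^ 2)) (q ^ 2) n / RtoC ((1 - q ^ 2) ^ n))%Cx.
Proof.
intros hq; pose proof (base_bounds q hq) as hp.
induction n as [|n IH]; cbn [qfact2 qpoch_part].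
- change (RtoC ((1 - q ^ 2) ^ 0)) with C1; change (RtoC 1) with C1.
  field; apply C1_neq0.
- unfold qint2; rewrite RtoC_mul, IH, RtoC_div, RtoC_sub by lra.
  change (RtoC 1) with C1.
  replace ((1 - q ^ 2) ^ S n) with ((1 - q ^ 2) ^ n * (1 - q ^ 2)) by (simpl; ring).
  replace ((q ^ 2) ^ S n) with (q ^ 2 * (q ^ 2) ^ n) by reflexivity.
  rewrite !RtoC_mul.
  field; split; [now apply one_sub_base_neq0|apply RtoC_neq0, pow_nonzero; lra].
Qed.

(** * Reduction of the series to Rogers' sum *)

(** This is the summand at [n = 0], since Rogers' series starts with 1. *)
Definition thm41_coef (q : R) (a b c d : Cx) : Cx :=
  ((C1 - qexp2 q a) * qshift2 q C1 (a - C1)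
   * qshift2 q Chalf (- b) * qshift2 q Chalf (- c) * qshift2 q Chalf (- d)
   / (RtoC (1 - q ^ 2) * qshift2 q Chalf (a + b) * qshift2 q Chalf (a + c)
      * qshift2 q Chalf (a + d)))%Cx.

(** The four shifted factorials above, and the three below together with the q-factorial, each yield
    a power [(1 - q^2)^(-n)]; these cancel. *)
Lemma thm41_term_phi65 (q : R) (a b c d : Cx) (n : nat) : 0 < q < 1 ->
  qGamma2_defined q a ->
  qGamma2_defined q (Chalf - b) -> qGamma2_defined q (Chalf - c) ->
  qGamma2_defined q (Chalf - d) ->
  qGamma2_defined q (Chalf + (a + b))%Cx -> qGamma2_defined q (Chalf + (a + c))%Cx ->
  qGamma2_defined q (Chalf + (a + d))%Cx ->
  thm41_term q a b c d n =
  (thm41_coef q a b c d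
   * phi65_term (q ^ 2) (qexp2 q a) (qexp2 q (Chalf - b)) (qexp2 q (Chalf - c))
       (qexp2 q (Chalf - d)) (qexp2 q (Chalf + (a + b))%Cx) (qexp2 q (Chalf + (a + c))%Cx)
       (qexp2 q (Chalf + (a + d))%Cx) (qexp2 q (a + b + (c + d) - Chalf)%Cx) n)%Cx.
Proof.
intros hq ha hb hc hd hab hac had; pose proof (base_bounds q hq) as hp.
pose proof (qGamma2_C1_defined q hq) as hg1; pose proof (qGamma2_half_defined q hq) as hgh.
pose proof (qpoch_head_neq0 _ _ hp ha) as hA1.
assert (hy : RtoC ((1 - q ^ 2) ^ n) <> C0) by (apply RtoC_neq0, pow_nonzero; lra).
assert (e1 : (C1 + (a - C1))%Cx = a) by ring.
unfold thm41_term, thm41_coef, phi65_term, phi65_weight.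
rewrite (qshift2_add_CN q C1 (a - C1)%Cx (a + CN n - C1)%Cx n hq), e1
  by (rewrite ?e1; auto; ring).
rewrite (qshift2_add_CN q Chalf (- b) (CN n - b)%Cx n hq) by (auto; ring).
rewrite (qshift2_add_CN q Chalf (- c) (CN n - c)%Cx n hq) by (auto; ring).
rewrite (qshift2_add_CN q Chalf (- d) (CN n - d)%Cx n hq) by (auto; ring).
rewrite (qshift2_add_CN q Chalf (a + b)%Cx (a + b + CN n)%Cx n hq) by auto.
rewrite (qshift2_add_CN q Chalf (a + c)%Cx (a + c + CN n)%Cx n hq) by auto.
rewrite (qshift2_add_CN q Chalf (a + d)%Cx (a + d + CN n)%Cx n hq) by auto.
rewrite RtoC_mul, RtoC_qfact2 by assumption.
replace (Cpow q (CN (4 * n) + RtoC 2 * a)%Cx)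
  with (qexp2 q a * RtoC ((q ^ 2) ^ n) * RtoC ((q ^ 2) ^ n))%Cx.
2: { rewrite <- qexp2_CN, <- !qexp2_add by lra; unfold qexp2; f_equal.
     unfold CN; rewrite mult_INR; apply Cx_ext; simpl; ring. }
(* The exponent is [2n (a + b + c + d - 1/2)], so the power of [q] is the [n]-th power of Rogers'
   argument. *)
replace (Cpow q (RtoC 2 * (a + b + (c + d)) * CN n - CN n)%Cx)
  with (Cx_pow (qexp2 q (a + b + (c + d) - Chalf)%Cx) n).
2: { unfold qexp2; rewrite <- Cpow_mul_CN; f_equal.
     unfold CN; apply Cx_ext; simpl; field. }
change (Chalf + - b)%Cx with (Chalf - b)%Cx.
change (Chalf + - c)%Cx with (Chalf - c)%Cx.
change (Chalf + - d)%Cx with (Chalf - d)%Cx.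
field; repeat split; auto using qpoch_part_neq0, qshift2_neq0, one_sub_base_neq0,
  qpoch_inf_base_neq0.
Qed.

(** Since [pi_q] equals [q^(1/4)] times the square of the q-gamma value at 1/2, [pi_q^2 / q^(1/2)]
    cancels the four such values left in the denominator after division by [thm41_coef]. *)
Lemma thm41_rhs_phi65 (q : R) (a b c d : Cx) : 0 < q < 1 ->
  qGamma2_defined q a ->
  qGamma2_defined q (Chalf - b) -> qGamma2_defined q (Chalf - c) ->
  qGamma2_defined q (Chalf - d) ->
  qGamma2_defined q (Chalf + (a + b))%Cx -> qGamma2_defined q (Chalf + (a + c))%Cx ->
  qGamma2_defined q (Chalf + (a + d))%Cx ->
  qGamma2_defined q (a + b + (c + d) - Chalf)%Cx ->
  qGamma2_defined q (a + b + c)%Cx -> qGamma2_defined q (a + b + d)%Cx ->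
  qGamma2_defined q (a + c + d)%Cx ->
  thm41_rhs q a b c d =
  (thm41_coef q a b c d
   * (qpoch_inf (qexp2 q a * RtoC (q ^ 2)) (q ^ 2) * qpoch_inf (qexp2 q (a + c + d)) (q ^ 2)
      * qpoch_inf (qexp2 q (a + b + d)) (q ^ 2) * qpoch_inf (qexp2 q (a + b + c)) (q ^ 2)
      / (qpoch_inf (qexp2 q (Chalf + (a + b))%Cx) (q ^ 2)
         * qpoch_inf (qexp2 q (Chalf + (a + c))%Cx) (q ^ 2)
         * qpoch_inf (qexp2 q (Chalf + (a + d))%Cx) (q ^ 2)
         * qpoch_inf (qexp2 q (a + b + (c + d) - Chalf)%Cx) (q ^ 2))))%Cx.
Proof.
intros hq ha hb hc hd hab hac had hs habc habd hacd.
pose proof (base_bounds q hq) as hp.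
pose proof (qGamma2_half_defined q hq) as hgh.
pose proof (qpoch_inf_base_neq0 _ hp) as hP.
pose proof (qpoch_head_neq0 _ _ hp ha) as hA1.
(* The gamma value at [a] involves the product from [A], Rogers' value the one from [Ap]; the factor
   [1 - A] in [thm41_coef] makes up the difference. *)
assert (hXA : qpoch_inf (qexp2 q a) (q ^ 2) =
  ((C1 - qexp2 q a) * qpoch_inf (qexp2 q a * RtoC (q ^ 2)) (q ^ 2))%Cx).
{ rewrite (qpoch_inf_add _ _ 1 hp), pow_1; cbn [qpoch_part]; simpl.
  change (RtoC 1) with C1; f_equal; ring. }
assert (hXA1 : qpoch_inf (qexp2 q a * RtoC (q ^ 2)) (q ^ 2) <> C0).
{ rewrite <- (pow_1 (q ^ 2)) at 1; now apply qpoch_inf_shift_neq0. }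
assert (hr : (RtoC (Rpower q (1 / 4)) * RtoC (Rpower q (1 / 4)))%Cx = RtoC (Rpower q (1 / 2))).
{ rewrite <- RtoC_mul, <- Rpower_plus; f_equal; f_equal; field. }
assert (hr0 : RtoC (Rpower q (1 / 4)) <> C0) by apply RtoC_neq0, Rgt_not_eq, exp_pos.
(* The half-integer arguments produce half powers of [1 - q^2], so the base itself is written as a
   square. *)
assert (hh : RtoC (1 - q ^ 2) = (Cpow (1 - q ^ 2) Chalf * Cpow (1 - q ^ 2) Chalf)%Cx).
{ rewrite <- Cpow_add, <- Cpow_C1 by lra; f_equal; apply Cx_ext; simpl; field. }
unfold thm41_rhs, thm41_coef, pi_q.
rewrite (qshift2_eq q C1 a (a - C1)%Cx) by ring.
rewrite (qshift2_eq q C1 (a + b + c)%Cx (a + b + c - C1)%Cx) by ring.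
rewrite (qshift2_eq q C1 (a + b + d)%Cx (a + b + d - C1)%Cx) by ring.
rewrite (qshift2_eq q C1 (a + c + d)%Cx (a + c + d - C1)%Cx) by ring.
rewrite (qshift2_eq q Chalf (a + b + (c + d) - Chalf)%Cx (a + b + (c + d) - C1)%Cx)
  by (apply Cx_ext; simpl; field).
rewrite !(qshift2_eq q Chalf _ _ eq_refl).
change (Chalf + - b)%Cx with (Chalf - b)%Cx.
change (Chalf + - c)%Cx with (Chalf - c)%Cx.
change (Chalf + - d)%Cx with (Chalf - d)%Cx.
rewrite !qGamma2_eq, qexp2_C1, qexp2_half, hXA, <- hr by lra.
rewrite qGamma2_defined_iff in *.
rewrite qexp2_half in hgh by lra.
(* The infinite products become variables, leaving a rational identity. *)
repeat match goal with
| |- context [qpoch_inf ?z (q ^ 2)] =>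
    let y := fresh "X" in set (y := qpoch_inf z (q ^ 2)) in *; clearbody y
end.
rewrite Cpow_C1 by lra.
repeat rewrite ?Cpow_add, ?Cpow_sub.
rewrite RtoC_mul, hh.
pose proof (Cpow_neq0 (1 - q ^ 2)) as hpow.
field; repeat split; auto using C1_neq0.
Qed.

Theorem theorem4p1 (q : R) (a b c d : Cx)
  (hq0 : 0 < q) (hq1 : q < 1)
  (hre : Re (Csub (Cadd (Cadd a b) (Cadd c d)) Chalf) > 0)
  (* every q^2-gamma value occurring is evaluated at a non-pole *)
  (hg_sum : forall n : nat,
      qGamma2_defined q (Cadd a (CN n)) /\
      qGamma2_defined q (Cadd Chalf (Csub (CN n) b)) /\
      qGamma2_defined q (Cadd Chalf (Csub (CN n) c)) /\
      qGamma2_defined q (Cadd Chalf (Csub (CN n) d)) /\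
      qGamma2_defined q (Cadd Chalf (Cadd (Cadd a b) (CN n))) /\
      qGamma2_defined q (Cadd Chalf (Cadd (Cadd a c) (CN n))) /\
      qGamma2_defined q (Cadd Chalf (Cadd (Cadd a d) (CN n))))
  (hg_rhs :
      qGamma2_defined q (Csub Chalf b) /\
      qGamma2_defined q (Csub Chalf c) /\
      qGamma2_defined q (Csub Chalf d) /\
      qGamma2_defined q (Csub (Cadd (Cadd a b) (Cadd c d)) Chalf) /\
      qGamma2_defined q (Cadd (Cadd a b) c) /\
      qGamma2_defined q (Cadd (Cadd a b) d) /\
      qGamma2_defined q (Cadd (Cadd a c) d)) :
  Cseries_cv (thm41_term q a b c d) (thm41_rhs q a b c d).
Proof.
assert (hq : 0 < q < 1) by lra.
pose proof (base_bounds q hq) as hp.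
destruct hg_rhs as (hb & hc & hd & hs & habc & habd & hacd).
(* At [n = 0] the non-pole conditions state that the infinite products attached to the parameters do
   not vanish. *)
destruct (hg_sum 0%nat) as (ha & _ & _ & _ & hab & hac & had).
assert (hadd0 : forall x, (x + CN 0)%Cx = x) by (intros x; change (CN 0) with C0; ring).
rewrite !hadd0 in *; clear hg_sum.
rewrite thm41_rhs_phi65 by assumption.
unfold Cseries_cv.
eapply C_cv_ext.
{ intros N; symmetry.
  etransitivity; [apply Csum_ext; intros n; apply thm41_term_phi65; assumption|].
  apply Csum_scal. }
apply C_cv_mul; [apply C_cv_const|].
pose proof (qexp2_neq0 q) as h0.
(* This is [E = Ap/B] and its analogues, from [1/2 + a + y = a + 1 - (1/2 - y)]. *)
assert (hE : forall y, qexp2 q (Chalf + (a + y))%Cx =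
          (qexp2 q a * RtoC (q ^ 2) / qexp2 q (Chalf - y))%Cx).
{ intros y; rewrite <- qexp2_C1, <- qexp2_add, <- qexp2_sub by lra.
  f_equal; apply Cx_ext; simpl; field. }
set (z := qexp2 q (a + b + (c + d) - Chalf)%Cx).
replace (qexp2 q (a + c + d)%Cx) with (z * qexp2 q (Chalf - b))%Cx
  by (unfold z; rewrite <- qexp2_add; f_equal; ring).
replace (qexp2 q (a + b + d)%Cx) with (z * qexp2 q (Chalf - c))%Cx
  by (unfold z; rewrite <- qexp2_add; f_equal; ring).
replace (qexp2 q (a + b + c)%Cx) with (z * qexp2 q (Chalf - d))%Cx
  by (unfold z; rewrite <- qexp2_add; f_equal; ring).
apply rogers_6phi5; auto.
- unfold z; rewrite <- qexp2_C1, <- !qexp2_add, <- qexp2_sub by lra.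
  f_equal; apply Cx_ext; simpl; field.
(* The modulus of [z] is [q] to the power twice the real part in [hre], which is less than 1 because
   [ln q < 0]. *)
- unfold z, qexp2; rewrite Cnorm_Cpow.
  replace (Re (RtoC 2 * _)%Cx) with (2 * Re (a + b + (c + d) - Chalf)%Cx)
    by (simpl; ring).
  unfold Rpower; rewrite <- exp_0; apply exp_increasing.
  assert (hl : ln q < 0) by (rewrite <- ln_1; apply ln_increasing; lra).
  nra.
Qed.
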